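(* Let $G$ be a finite group, let $\sigma$ be an automorphism of $G$ of order two, and let $S\subseteq G$ be a symmetric subset that is closed under conjugation by the elements of $G$. Suppose that the twisted Cayley graph $C(G,S)^\sigma$ is undirected and connected. Then the cop number of $C(G,S)^\sigma$ is at most $2|S|$.
   Context: A subset $S$ of a group $G$ is symmetric if $S=S^{-1}$, where $S^{-1}=\{s^{-1}: s\in S\}$; it is closed under conjugation if $gsg^{-1}\in S$ for all $s\in S$, $g\in G$. For an automorphism $\sigma$ of $G$, the twisted Cayley graph $C(G,S)^\sigma$ has $G$ as its set of vertices, and there is an edge from $x$ to $y$ if $y=\sigma(xs)$ for some $s\in S$ (loops may occur). Such a graph is undirected if its edge relation is symmetric, i.e. whenever there is an edge from $x$ to $y$ there is also an edge from $y$ to $x$. The game of cops and robbers on a finite connected graph is played as follows, with all positions visible to both sides. First, each of the cops chooses a vertex (several cops may occupy the same vertex); then the robber chooses a vertex. The cops and the robber then alternate turns, the cops going first; on a turn, players move along edges of the graph. In the cops' turn each cop may move along an edge or stay in place. It is assumed that the robber moves along some edge in each of its turns (a loop counts as an edge); the robber may not stay idle. The robber is captured when a cop and the robber occupy the same vertex. The cop number of the graph is the minimum number of cops required to capture the robber (after finitely many turns) no matter how the robber plays. *)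

(* Defs.v *)
From mathcomp Require Import all_boot all_fingroup boolp.

Set Implicit Arguments.
Unset Strict Implicit.
Unset Printing Implicit Defensive.

Definition twisted_cayley (gT : finGroupType) (S : {set gT}) (sigma : gT -> gT) :
    rel gT :=
  fun x y => [exists s in S, y == sigma (x * s)%g].

Definition connected_graph (V : finType) (e : rel V) : Prop :=
  forall x y, connect e x y.

Section CopsAndRobbers.

Variables (V : finType) (e : rel V).

Definition cops_move k (c c' : 'I_k -> V) : Prop :=
  forall i, c' i = c i \/ e (c i) (c' i).

(* [cops_force c r]: with the cops at [c], the robber at [r] and the cops to   *)
(* move, the cops can force a capture within finitely many turns. The premise  *)
(* [exists r', e r r'] ensures that a robber without any legal move does not   *)
(* count as captured; in a connected graph with at least two vertices such a   *)
(* move always exists.                                                         *)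
Inductive cops_force k : ('I_k -> V) -> V -> Prop :=
| CapturedAlready c r i of c i = r : cops_force c r
| CapturedByMove c c' r i of cops_move c c' & c' i = r : cops_force c r
| NextRound c c' r of cops_move c c' & (exists r', e r r')
    & (forall r', e r r' -> cops_force c' r') : cops_force c r.

Definition cops_win k : Prop :=
  exists c : 'I_k -> V, forall r, cops_force c r.

Lemma cops_win_exists : exists k, `[< cops_win k >].
Proof.
exists #|V|; apply/asboolP; exists enum_val => r.
by apply: (CapturedAlready (i := enum_rank r)); rewrite enum_rankK.
Qed.

Definition cop_number : nat := ex_minn cops_win_exists.

End CopsAndRobbers.

(* Main.v *)
Require Import Defs.
From mathcomp Require Import all_boot all_fingroup.

(* Let E = c^-1 * r be the displacement between a cop c and the robber r, read
   through the automorphism tau = sigma^n in round n.  If the robber uses s in S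
   and w := tau s, then, S being normal, the cop can turn E into E * v^-1 * w
   for any v in S that it likes.  Taking v = w preserves E; but a cop that waits
   for one fixed w, with E a product of m elements of w^-1 * S, can drop one of
   these factors whenever the robber plays w.  With one such cop for each w in S
   the total number of factors decreases at every move of the robber.  For every
   w the group generated by w^-1 * S contains S * S, and by connectedness each
   element of G is a product of elements of S, so that stationing |S| cops at 1
   and |S| cops at some element of S makes one of these two teams suitable. *)

Lemma AutM {gT : finGroupType} (tau : {perm gT}) :
  tau \in Aut [set: gT] -> {morph tau : x y / (x * y)%g}.
Proof. by move=> /Aut_morphic/morphicP tauM x y; apply: tauM; rewrite inE. Qed.

Lemma AutV {gT : finGroupType} (tau : {perm gT}) :
  tau \in Aut [set: gT] -> {morph tau : x / (x^-1)%g}.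
Proof.
move=> /AutM tauM x.
have tau1 : tau 1%g = 1%g by apply: (mulIg (tau 1%g)); rewrite -tauM !mul1g.
by apply: (mulIg (tau x)); rewrite -tauM !mulVg.
Qed.

(** The edge from [1] to [sigma x] must be reversible, say by [s]. Then [x * sigma s = 1], whence
    [sigma x = s^-1]. *)
Lemma twisted_cayley_stable {gT : finGroupType} {sigma : {perm gT}}
    {S : {set gT}} :
  sigma \in Aut [set: gT] -> involutive sigma -> S = (S^-1)%g ->
  symmetric (twisted_cayley S sigma) -> forall x, (sigma x \in S) = (x \in S).
Proof.
move=> sigma_aut sigmaK SV e_sym.
have tauM := AutM _ sigma_aut.
have stable x : x \in S -> sigma x \in S.
  move=> xS; have : twisted_cayley S sigma 1%g (sigma x).
    by apply/exists_inP; exists x; rewrite ?mul1g.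
  rewrite e_sym => /exists_inP[s sS /eqP].
  rewrite tauM sigmaK => /esym/eqP; rewrite -eq_invg_mul => /eqP xs.
  have /(congr1 sigma) : (sigma s)^-1%g = x by rewrite -xs invgK.
  by rewrite AutV // sigmaK => <-; rewrite SV inE invgK.
by move=> x; apply/idP/idP => [/stable|/stable //]; rewrite sigmaK.
Qed.

Lemma cop_response {gT : finGroupType} {sigma tau : {perm gT}} {S : {set gT}}
    (w c r s : gT) (m : nat) :
  sigma \in Aut [set: gT] -> involutive sigma ->
  tau \in Aut [set: gT] -> (forall x, (tau x \in S) = (x \in S)) ->
  (forall x g : gT, x \in S -> (g * x * g^-1)%g \in S) -> s \in S ->
  tau (c^-1 * r)%g \in ((w^-1 *: S) ^+ m.+1)%g ->
  exists2 y, twisted_cayley S sigma c y &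
    (sigma * tau)%g (y^-1 * sigma (r * s))%g
      \in ((w^-1 *: S) ^+ (m.+1 - (tau s == w)))%g.
Proof.
move=> sigma_aut sigmaK tau_aut tauS conjS sS; set E := tau _ => ES.
have respond v : v \in S -> exists2 y, twisted_cayley S sigma c y &
    (sigma * tau)%g (y^-1 * sigma (r * s))%g = (E * v^-1 * tau s)%g.
  (* Conjugating by [E] moves the cop's factor past [E]: the new displacement is
     [tau (t^-1 * c^-1 * r * s)], that is [(E * v^-1 * E^-1) * E * tau s]. *)
  move=> vS; pose t := (tau^-1 (E * v * E^-1))%g.
  have tau_t : tau t = (E * v * E^-1)%g by rewrite /t permKV.
  exists (sigma (c * t)%g).
    by apply/exists_inP; exists t => //; rewrite -tauS tau_t conjS.
  rewrite -(AutV _ sigma_aut) -(AutM _ sigma_aut) permM sigmaK.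
  rewrite invMg -!mulgA (mulgA c^-1%g) 2!(AutM _ tau_aut) (AutV _ tau_aut).
  by rewrite tau_t -/E !invMg invgK -!mulgA mulKg.
(* If [tau s = w], answering with the [v] of the last factor [w^-1 * v] of [E] cancels that factor;
   otherwise [v = tau s] leaves [E] unchanged. *)
case: eqP => [sw | _].
  move: ES; rewrite expgSr => /mulsgP[E' _ E'S /lcosetP[v vS ->] EE'].
  have [y cy yE] := respond v vS; exists y => //.
  by rewrite yE EE' sw subn1 /= !mulgA mulgK mulgKV.
have [|y cy yE] := respond (tau s); first by rewrite tauS.
by exists y => //; rewrite yE mulgKV subn0.
Qed.

(* The cops in [A] are the active ones; cop [i] waits for the robber to use
   [w i].  The robber has just moved from [r] to [r']. *)
Lemma cops_force_team {gT : finGroupType} {sigma : {perm gT}} {S : {set gT}}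
    {k : nat} (w : 'I_k -> gT) (A : {set 'I_k}) :
  sigma \in Aut [set: gT] -> involutive sigma ->
  (forall x, (sigma x \in S) = (x \in S)) ->
  (forall x g : gT, x \in S -> (g * x * g^-1)%g \in S) ->
  (forall x, x \in S -> exists2 i, i \in A & w i = x) ->
  forall (tau : {perm gT}) (m : 'I_k -> nat) (c : 'I_k -> gT) (r r' : gT),
  tau \in Aut [set: gT] -> (forall x, (tau x \in S) = (x \in S)) ->
  {in A, forall i, 0 < m i /\
    tau ((c i)^-1 * r)%g \in (((w i)^-1 *: S) ^+ m i)%g} ->
  twisted_cayley S sigma r r' ->
  cops_force (twisted_cayley S sigma) c r'.
Proof.
move=> sigma_aut sigmaK sigmaS conjS wA tau m.
have [N] := ubnP (\sum_(i in A) m i).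
elim: N => // N IH in tau m *; rewrite ltnS => leN c r r' tau_aut tauS cA.
case/exists_inP=> s sS /eqP->.
pose m' i := m i - (tau s == w i).
have [i|c' c'P] := fin_all_exists (P := fun i y =>
    (y = c i \/ twisted_cayley S sigma (c i) y) /\
    (i \in A -> (sigma * tau)%g (y^-1 * sigma (r * s))%g
       \in (((w i)^-1 *: S) ^+ m' i)%g)).
  have [iA|_] := boolP (i \in A); last by exists (c i); split; first by left.
  case: (cA i iA); rewrite /m'; case: (m i) => // mi _ Ei.
  have [y cy yE] :=
    cop_response _ _ _ _ _ sigma_aut sigmaK tau_aut tauS conjS sS Ei.
  by exists y; split; first by right.
have c_move : cops_move (twisted_cayley S sigma) c c' by move=> i; case: (c'P i).
(* An empty product means displacement 1, so that cop has just landed on the robber. *)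
case: (boolP [exists i in A, m' i == 0]) => [/exists_inP[i iA /eqP mi0] | ].
  apply: (CapturedByMove c_move (i := i)).
  case: (c'P i) => _ /(_ iA); rewrite mi0 expg0 => /set1P.
  rewrite -[1%g](mulVg ((sigma * tau)%g (sigma (r * s)%g))).
  have st_aut : (sigma * tau)%g \in Aut [set: gT] by rewrite groupM.
  by rewrite (AutM _ st_aut) (AutV _ st_aut) => /mulIg/invg_inj/perm_inj.
rewrite negb_exists_in => /forall_inP m'A.
apply: (NextRound c_move).
  by exists (sigma (sigma (r * s) * s)%g); apply/exists_inP; exists s.
move=> r''; apply: (IH (sigma * tau)%g m').
(* The active cop waiting for [tau s] loses a factor; since [m i > 0], the truncated subtraction in
   [m'] really decreases the sum. *)
- have [|i iA wi] := wA (tau s); first by rewrite tauS.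
  apply: leq_trans leN; rewrite (bigD1 i) //= [X in _ < X](bigD1 i) //= -addSn.
  apply: leq_add; last by apply: leq_sum => j _; apply: leq_subr.
  by rewrite /m' wi eqxx subn1 prednK //; case: (cA i iA).
- by rewrite groupM.
- by move=> x; rewrite permM tauS sigmaS.
by move=> i iA; split; [rewrite lt0n m'A | case: (c'P i) => _; apply].
Qed.

Lemma twisted_cayley_connect1 {gT : finGroupType} {sigma : {perm gT}}
    {S : {set gT}} :
  sigma \in Aut [set: gT] -> (forall x, (sigma x \in S) = (x \in S)) ->
  forall x, connect (twisted_cayley S sigma) 1%g x ->
  exists n, x \in (S ^+ n)%g.
Proof.
move=> sigma_aut sigmaS x /connectP[p + ->] {x}.
elim/last_ind: p => [|p y IH]; first by exists 0; rewrite expg0 set11.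
rewrite last_rcons rcons_path => /andP[/IH[n] xSn /exists_inP[s sS /eqP->]].
exists n.+1; have: (last 1 p * s)%g \in (S ^+ n.+1)%g by rewrite expgSr mem_mulg.
(* The power [S ^+ n.+1] is stable under [sigma], because [S] is. *)
elim: {n xSn}n.+1 (_ * s)%g => [|n IHn] y'.
  rewrite expg0 => /set1P->; rewrite -[1%g](mulgV 1%g).
  by rewrite (AutM _ sigma_aut) (AutV _ sigma_aut) mulgV set11.
rewrite expgS => /mulsgP[a b aS /IHn bS ->].
by rewrite (AutM _ sigma_aut) mem_mulg ?sigmaS.
Qed.

(** As [w^-1 *: S] contains 1, one of its powers is the whole subgroup it generates; hence a single
    [m] serves all [n]. *)
Lemma even_expgs_sub {gT : finGroupType} {S : {set gT}} {w : gT} :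
  S = (S^-1)%g -> w \in S ->
  exists m, forall n, ((S ^+ n.*2)%g \subset ((w^-1 *: S) ^+ m)%g).
Proof.
move=> SV wS; have [m defm] := gen_expgs (w^-1 *: S)%g; exists m => n.
have -> : (w^-1 *: S = 1 |: w^-1 *: S)%g.
  by apply/esym/setUidPr; rewrite sub1set mem_lcoset invgK mulg1.
rewrite -defm -mul2n expgM.
elim: n => [|n IH]; first by rewrite expg0 sub1set group1.
rewrite expgS mul_subG //; apply/subsetP => _ /mulsgP[a b aS bS ->].
have -> : (a * b = (w^-1 * a^-1)^-1 * (w^-1 * b))%g.
  by rewrite invMg !invgK !mulgA mulgK.
by rewrite groupM ?groupV // mem_gen // mem_lcoset invgK mulKVg // SV inE invgK.
Qed.

Theorem theorem1p2 (gT : finGroupType) (sigma : {perm gT}) (S : {set gT})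
  (sigma_aut : sigma \in Aut [set: gT]) (sigma_order : #[sigma]%g = 2)
  (S_symmetric : S = (S^-1)%g)
  (S_conj : forall s g : gT, s \in S -> (g * s * g^-1)%g \in S)
  (undirected : symmetric (twisted_cayley S sigma))
  (connected : connected_graph (twisted_cayley S sigma)) :
  cop_number (twisted_cayley S sigma) <= 2 * #|S|.
Proof.
have sigmaK : involutive sigma.
  by move=> x; rewrite -permM -expg2 -sigma_order expg_order perm1.
have sigmaS := twisted_cayley_stable sigma_aut sigmaK S_symmetric undirected.
rewrite /cop_number; case: ex_minnP => k _; apply; apply/boolp.asboolP.
have S_gen x := twisted_cayley_connect1 sigma_aut sigmaS x (connected 1%g x).
have [s0 s0S] : exists s0, s0 \in S.
  (* With [S] empty, connectedness would make the group trivial and [sigma] of order 1. *)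
  apply/set0Pn; apply: contra_eq_neq sigma_order => S0.
  suff -> : sigma = 1%g by rewrite order1.
  apply/permP => x; rewrite perm1.
  have all1 (y : gT) : y = 1%g.
    have [[|n]] := S_gen y; first by rewrite expg0 => /set1P.
    by rewrite expgS S0 => /mulsgP[a b]; rewrite inE.
  by rewrite (all1 x) (all1 (sigma _)).
rewrite mul2n -addnn.
pose c (i : 'I_(#|S| + #|S|)) := if split i is inl _ then 1%g else s0.
pose w (i : 'I_(#|S| + #|S|)) :=
  match split i with inl j | inr j => enum_val j end.
have wS i : w i \in S by rewrite /w; case: (split i) => j; apply: enum_valP.
exists c => r.
have [A wA [n An]] : exists2 A : {set 'I_(#|S| + #|S|)},
    (forall x, x \in S -> exists2 i, i \in A & w i = x) &
    exists n, {in A, forall i, ((c i)^-1 * r)%g \in (S ^+ n.*2)%g}.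
  (* Only even powers of [S] are usable: for odd [n], starting at [s0] contributes the extra factor
     [s0^-1]. *)
  have [n rSn] := S_gen r; case: (boolP (odd n)) => nodd.
    exists [set i | c i == s0].
      move=> x xS; exists (rshift _ (enum_rank_in xS x)).
        by rewrite inE /c (unsplitK (inr _)).
      by rewrite /w (unsplitK (inr _)) enum_rankK_in.
    exists (uphalf n) => i; rewrite inE => /eqP->.
    rewrite odd_uphalfK // expgS mem_mulg //.
    by rewrite S_symmetric inE invgK.
  exists [set i | c i == 1%g].
    move=> x xS; exists (lshift _ (enum_rank_in xS x)).
      by rewrite inE /c (unsplitK (inl _)).
    by rewrite /w (unsplitK (inl _)) enum_rankK_in.
  exists n./2 => i; rewrite inE => /eqP->.
  by rewrite even_halfK // invg1 mul1g.
have [m mP] : exists m : 'I_(#|S| + #|S|) -> nat, forall i, i \in A ->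
    ((c i)^-1 * r)%g \in (((w i)^-1 *: S) ^+ m i)%g.
  apply: (fin_all_exists (P := fun i m => i \in A ->
    ((c i)^-1 * r)%g \in (((w i)^-1 *: S) ^+ m)%g)) => i.
  have [m /(_ n)/subsetP sub] := even_expgs_sub S_symmetric (wS i).
  by exists m => iA; apply: sub; apply: An.
case: (boolP [exists i in A, m i == 0]) => [/exists_inP[i iA /eqP mi0] | ].
  apply: (CapturedAlready _ (i := i)).
  move: (mP i iA); rewrite mi0 expg0 => /set1P/eqP.
  by rewrite -eq_invg_mul invgK => /eqP.
rewrite negb_exists_in => /forall_inP mA.
(* The cops pass their first turn, so that the robber's reply starts the team strategy with
   [tau = 1]. *)
apply: (@NextRound _ _ _ c c); first by left.
  by exists (sigma (r * s0)%g); apply/exists_inP; exists s0.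
move=> r'; apply: (cops_force_team w A _ _ _ _ _ 1%g m c r) => //.
  by move=> x; rewrite perm1.
by move=> i iA; rewrite perm1 lt0n mA; last exact: iA; split=> //; apply: mP.
Qed.
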